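(* Let $X_1,\dots,X_n$ be independent Bernoulli random variables with $\mathbb{P}(X_i=1)=1-\mathbb{P}(X_i=0)=p_i\in[0,1]$, $1\le i\le n$, with the $p_i$ not all zero, and let $W=\sum_{i=1}^nX_i$. For $r\ge1$ put $\lambda_r=\sum_{i=1}^np_i^r$, $\lambda=\lambda_1$ and $\theta_r=\lambda_r/\lambda_1$. Set $$\beta=\lambda^2\lambda_2^{-1}-1-2\lambda+2\lambda_3\lambda_2^{-1},\qquad \alpha=\beta\lambda+\lambda^2-\lambda_2.$$ If $\lambda^2\lambda_2^{-1}-1-2\lambda\ge0$, then $$d_W\big(\mathcal{L}(W),\mathrm{PBD}(\alpha;0,\beta,1)\big)\le 3\theta_3+\frac{6\theta_2\lambda_2}{\lambda-\lambda_2-(1+\theta_2)\theta_2}.$$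
   Context: $\mathbb{Z}_+=\{0,1,2,\dots\}$. $\mathcal{L}(W)$ denotes the distribution of $W$. The Wasserstein distance between probability distributions $\mathcal{P},\mathcal{Q}$ on $\mathbb{Z}_+$ is $$d_W(\mathcal{P},\mathcal{Q})=\sup_{f\in\mathcal{F}}\left|\int f\,d\mathcal{P}-\int f\,d\mathcal{Q}\right|,$$ where $\mathcal{F}$ is the set of functions $f:\mathbb{Z}_+\to\mathbb{R}$ with $|f(x)-f(y)|\le|x-y|$ for all $x,y\in\mathbb{Z}_+$. The polynomial birth-death distribution $\mathrm{PBD}(\alpha;0,\beta,1)$ is the probability distribution $\pi=(\pi_n)_{n\in\mathbb{Z}_+}$ on $\mathbb{Z}_+$ given by $$\pi_n=\frac{\prod_{i=0}^{n-1}\alpha_i}{\prod_{i=1}^n\beta_i}\left(1+\sum_{j=1}^\infty\frac{\prod_{i=0}^{j-1}\alpha_i}{\prod_{i=1}^j\beta_i}\right)^{-1},\qquad \alpha_i=\alpha,\quad \beta_i=\beta i+i(i-1).$$ *)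

(* Defs.v *)
From HB Require Import structures.
From mathcomp Require Import all_boot all_order all_algebra.
From mathcomp Require Import all_classical all_reals all_analysis.

Set Implicit Arguments.
Unset Strict Implicit.
Unset Printing Implicit Defensive.

Import Order.TTheory GRing.Theory Num.Theory.
Import numFieldNormedType.Exports.

Local Open Scope classical_set_scope.
Local Open Scope ring_scope.

Section wasserstein.
Context {R : realType}.

Definition lip1 : set (nat -> R) :=
  [set f | forall x y : nat, `|f x - f y| <= `|x%:R - y%:R|].

(* Valued in the extended reals, so that the supremum needs no side condition
   and an inequality [wasserstein P Q <= c%:E] bounds every test function. *)
Definition wasserstein (P Q : probability nat R) : \bar R :=
  ereal_sup [set `| \int[P]_x (f x)%:E - \int[Q]_x (f x)%:E |%E | f in lip1].

End wasserstein.

Section birth_death.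
Context {R : realType}.
Implicit Types (a b : nat -> R) (alpha beta : R).

Definition bd_weight a b (n : nat) : R :=
  (\prod_(0 <= i < n) a i) / \prod_(1 <= i < n.+1) b i.

Definition bd_pmf a b (n : nat) : R :=
  bd_weight a b n * (1 + limn (fun N => \sum_(1 <= j < N) bd_weight a b j))^-1.

Definition pbd_birth alpha : nat -> R := fun=> alpha.

Definition pbd_death beta : nat -> R :=
  fun i => beta * i%:R + i%:R * (i%:R - 1).

Definition pbd_pmf alpha beta : nat -> R :=
  bd_pmf (pbd_birth alpha) (pbd_death beta).

(* PBD(alpha; 0, beta, 1). The guard only serves to make this a probability
   for all real parameters; it holds for the parameters used below, see
   [pbd_params_valid]. *)
Definition pbd alpha beta : set nat -> \bar R := fun U =>
  if (0 <= alpha) && (0 < beta) then \esum_(k in U) (pbd_pmf alpha beta k)%:E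
  else \d_0%N U.

End birth_death.

Section pbd_probability.
Context {R : realType} (alpha beta : R).

Let w := bd_weight (pbd_birth alpha) (pbd_death beta).

Let pbd_deathS i :
  pbd_death beta i.+1 = (beta + i%:R) * i.+1%:R.
Proof. by rewrite /pbd_death -natr1 addrK [RHS]mulrDl [in RHS](mulrC i%:R). Qed.

Let prod_ge n : 0 < beta ->
  beta ^+ n * n`!%:R <= \prod_(1 <= i < n.+1) pbd_death beta i.
Proof.
move=> b0; elim: n => [|n ih]; first by rewrite big_geq// expr0 mul1r.
rewrite big_nat_recr//= exprSr factS mulnC natrM mulrACA.
apply: ler_pM => //; first by rewrite mulr_ge0 ?exprn_ge0// ltW.
  by rewrite mulr_ge0// ltW.
by rewrite pbd_deathS ler_wpM2r// lerDl.
Qed.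

Let prod_gt0 n : 0 < beta -> 0 < \prod_(1 <= i < n.+1) pbd_death beta i.
Proof.
move=> b0; apply: lt_le_trans (prod_ge n b0).
by rewrite mulr_gt0 ?exprn_gt0// ltr0n fact_gt0.
Qed.

Let w_ge0 n : 0 <= alpha -> 0 < beta -> 0 <= w n.
Proof.
move=> a0 b0; apply: divr_ge0; first exact: prodr_ge0.
by rewrite ltW// prod_gt0.
Qed.

Let w_le n : 0 <= alpha -> 0 < beta -> w n <= exp_coeff (alpha / beta) n.
Proof.
move=> a0 b0; rewrite /w /bd_weight /pbd_birth /exp_coeff/=.
rewrite prodr_const_nat subn0 expr_div_n -mulrA -invfM.
rewrite ler_wpM2l ?exprn_ge0// lef_pV2 ?posrE ?prod_gt0//; first exact: prod_ge.
by rewrite mulr_gt0 ?exprn_gt0// ltr0n fact_gt0.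
Qed.

Let w0 : w 0 = 1. Proof. by rewrite /w /bd_weight !big_geq// divr1. Qed.

Let w_cvg : 0 <= alpha -> 0 < beta -> cvgn (series w).
Proof.
move=> a0 b0; apply: (series_le_cvg _ _ _ (is_cvg_series_exp_coeff (alpha / beta))).
- by move=> n; exact: w_ge0.
- by move=> n; rewrite (le_trans (w_ge0 n _ _)) ?w_le.
- by move=> n; exact: w_le.
Qed.

Let w_lim : 0 <= alpha -> 0 < beta ->
  1 + limn (fun N => \sum_(1 <= j < N) w j) = limn (series w).
Proof.
move=> a0 b0.
have e : (fun N => \sum_(1 <= j < N.+1) w j) = (fun N => series w N.+1 - 1).
  apply/funext => N; rewrite /series/= [in RHS]big_ltn// w0.
  by rewrite addrAC subrr add0r.
have h : (fun N => series w N.+1) @ \oo --> limn (series w).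
  by rewrite (cvg_shiftS (series w)); exact: w_cvg.
have : (fun N => \sum_(1 <= j < N.+1) w j) @ \oo --> limn (series w) - 1.
  by rewrite e; apply: cvgB => //; exact: cvg_cst.
rewrite (cvg_shiftS (fun N => \sum_(1 <= j < N) w j)) => /cvg_lim -> //.
by rewrite addrC subrK.
Qed.

Let lim_gt0 : 0 <= alpha -> 0 < beta -> 0 < limn (series w).
Proof.
move=> a0 b0; apply: (@lt_le_trans _ _ (series w 1)).
  by rewrite /series/= big_nat1 w0.
apply: nondecreasing_cvgn_le; last exact: w_cvg.
by apply: nondecreasing_series => n _ _; exact: w_ge0.
Qed.

Let pmfE n : 0 <= alpha -> 0 < beta ->
  pbd_pmf alpha beta n = w n / limn (series w).
Proof. by move=> a0 b0; rewrite /pbd_pmf /bd_pmf w_lim. Qed.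

Lemma pbd_pmf_ge0 n : 0 <= alpha -> 0 < beta -> 0 <= pbd_pmf alpha beta n.
Proof.
by move=> a0 b0; rewrite pmfE// divr_ge0 ?w_ge0// ltW// lim_gt0.
Qed.

Local Open Scope ereal_scope.

Let pbd0 : pbd alpha beta set0 = 0.
Proof. by rewrite /pbd measure0; case: ifPn => //; rewrite esum_set0. Qed.

Let pbd_ge0 U : 0 <= pbd alpha beta U.
Proof.
rewrite /pbd; case: ifPn => // /andP[a0 b0]; apply: esum_ge0 => /= n Un.
by rewrite lee_fin pbd_pmf_ge0.
Qed.

Let pbd_sigma_additive : semi_sigma_additive (pbd alpha beta).
Proof.
move=> F mF tF mUF; rewrite /pbd; case: ifPn => [/andP[a0 b0]|_]; last first.
  exact: measure_semi_sigma_additive.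
apply: cvg_toP.
  apply: ereal_nondecreasing_is_cvgn => a b ab.
  apply: lee_sum_nneg_natr => // n _ _.
  by apply: esum_ge0 => /= ? _; rewrite lee_fin pbd_pmf_ge0.
by rewrite nneseries_sum_bigcup// => i; rewrite lee_fin pbd_pmf_ge0.
Qed.

HB.instance Definition _ := isMeasure.Build _ _ _ (pbd alpha beta)
  pbd0 pbd_ge0 pbd_sigma_additive.

Let pbd_setT : pbd alpha beta [set: nat] = 1.
Proof.
rewrite /pbd; case: ifPn => [/andP[a0 b0]|_]; last by rewrite probability_setT.
rewrite -nneseries_esumT; last by move=> *; rewrite lee_fin pbd_pmf_ge0.
under eq_eseriesr => n _ do rewrite pmfE// mulrC EFinM.
rewrite nneseriesZl/=; last by move=> n _; rewrite lee_fin w_ge0.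
have -> : \sum_(0 <= i <oo) (w i)%:E = (limn (series w))%:E.
  rewrite -EFin_lim; last exact: w_cvg.
  by apply/congr_lim/funext => n /=; rewrite /series/= sumEFin.
by rewrite -EFinM mulVf// gt_eqF// lim_gt0.
Qed.

HB.instance Definition _ :=
  @Measure_isProbability.Build _ _ R (pbd alpha beta) pbd_setT.

Lemma pbd_set1 n : (0 <= alpha)%R -> (0 < beta)%R ->
  pbd alpha beta [set n] = (pbd_pmf alpha beta n)%:E.
Proof.
by move=> a0 b0; rewrite /pbd a0 b0 esum_set1// lee_fin pbd_pmf_ge0.
Qed.

End pbd_probability.

Section random_variables.
Context {d : measure_display} {T : measurableType d} {R : realType}.
Context {P : probability T R}.

Definition mutually_independent {d'} {T' : measurableType d'} {I : finType}
    (X : I -> {RV P >-> T'}) : Prop :=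
  forall (J : {set I}) (B : I -> set T'), (forall i, measurable (B i)) ->
    P (\bigcap_(i in [set` J]) X i @^-1` B i) =
    (\prod_(i in J) P (X i @^-1` B i))%E.

Context {n : nat} (X : 'I_n -> {RV P >-> nat}).

Definition rv_sum (t : T) : nat := (\sum_(i < n) X i t)%N.

Let measurable_rv_sum : measurable_fun [set: T] rv_sum.
Proof.
suff h (s : seq 'I_n) :
    measurable_fun [set: T] (fun t => (\sum_(i <- s) X i t)%N) by exact: h.
elim: s => [|i s ih].
  rewrite (_ : (fun _ => _) = cst 0%N); last by apply/funext => t; rewrite big_nil.
  exact: measurable_cst.
move=> mT B mB.
rewrite setTI (_ : _ @^-1` _ = \bigcup_k ((X i @^-1` [set k]) `&`
    ((fun t => (\sum_(i <- s) X i t)%N) @^-1` [set m | B (k + m)%N]))); last first.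
  apply/seteqP; split => t /=.
    by rewrite big_cons => Bt; exists (X i t).
  by move=> [k _ [/= <-]]; rewrite big_cons.
apply: bigcupT_measurable => k; apply: measurableI.
  by rewrite -[X in measurable X]setTI; exact: measurable_funP.
by rewrite -[X in measurable X]setTI; exact: ih.
Qed.

HB.instance Definition _ := isMeasurableFun.Build _ _ _ _ rv_sum
  measurable_rv_sum.

End random_variables.

Section bernoulli_parameters.
Context {R : realType} {n : nat} (p : 'I_n -> R).

Definition lambda_ (r : nat) : R := \sum_(i < n) p i ^+ r.

Definition theta_ (r : nat) : R := lambda_ r / lambda_ 1.

Definition pbd_beta : R :=
  lambda_ 1 ^+ 2 / lambda_ 2 - 1 - 2 * lambda_ 1 + 2 * lambda_ 3 / lambda_ 2.

Definition pbd_alpha : R :=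
  pbd_beta * lambda_ 1 + lambda_ 1 ^+ 2 - lambda_ 2.

Lemma lambda_gt0 r :
  (forall i, 0 <= p i <= 1) -> (exists i, p i != 0) -> 0 < lambda_ r.
Proof.
move=> p01 p_neq0; have p0 i : 0 <= p i by case/andP: (p01 i).
have [i pi0] := p_neq0.
rewrite /lambda_ (bigD1 i)//= ltr_pwDl ?sumr_ge0//.
  by rewrite exprn_gt0// lt_def pi0 p0.
by move=> j _; rewrite exprn_ge0.
Qed.

Lemma pbd_params_valid :
  (forall i, 0 <= p i <= 1) -> (exists i, p i != 0) ->
  0 <= lambda_ 1 ^+ 2 / lambda_ 2 - 1 - 2 * lambda_ 1 ->
  0 <= pbd_alpha /\ 0 < pbd_beta.
Proof.
move=> p01 p_neq0 h; have b0 : 0 < pbd_beta.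
  by rewrite /pbd_beta ltr_wpDl// divr_gt0 ?mulr_gt0 ?lambda_gt0.
split=> //; rewrite /pbd_alpha -addrA addr_ge0//.
  by rewrite mulr_ge0// ltW// lambda_gt0.
rewrite subr_ge0 -(mul1r (lambda_ 2)) -ler_pdivlMr ?lambda_gt0// -subr_ge0.
apply: le_trans h _; rewrite gerDl oppr_le0.
by rewrite mulr_ge0// ltW// lambda_gt0.
Qed.

End bernoulli_parameters.

(* Main.v *)
(* Stein's method.  Write D i = beta i + i (i - 1) for the death rate.  For f
   1-Lipschitz let g solve alpha g(i+1) - D i g(i) = f(i) - pi(f), with pi the
   polynomial birth-death law; then
   E f(W) - pi(f) = E[alpha g(W+1) - D_W g(W)].

   With G the generating function of W and Y = X - 1, the right-hand side pairs
   g with X (alpha G - beta G' - X G'').  The choice of alpha and beta cancels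
   the terms in G and Y G, so only second differences of g remain, with total
   weight at most beta lambda_3 + 2 lambda lambda_2.

   It remains to see that |g(i+2) - 2 g(i+1) + g(i)| <= 3 / alpha for i >= 1.
   With F the distribution function of pi, u = F / (alpha pi) is nondecreasing
   and convex, v = (1 - F) / (alpha pi) is nonincreasing and convex.  Summation
   by parts gives -g(i+1) = H_i u(i) + L_i v(i), where L_i sums the increments
   of f before i against F, and H_i those from i on against 1 - F.  A second
   difference of -g is a combination of second differences of u and v, at most
   its value P >= 0 for f = id in absolute value, minus an increment of f times
   some N in [0, 1/alpha].  For f = id this is P - N, which minimum principles
   for the increments of g bound by 1/alpha; hence P + N <= 3 / alpha. *)
Require Import Defs.
From mathcomp Require Import all_boot all_order all_algebra.
From mathcomp Require Import all_classical all_reals all_analysis.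
From mathcomp Require Import ring lra.

Import Order.TTheory GRing.Theory Num.Theory.
Import numFieldNormedType.Exports.

Local Open Scope classical_set_scope.
Local Open Scope ring_scope.

(** * The Stein equation and its solution *)

(** A sequence with nonnegative lower limit and some negative value attains a negative minimum,
    which the second hypothesis forbids. *)
Lemma minimum_principle {R : realType} (x : nat -> R) :
  (forall eps, 0 < eps -> exists N, forall j, (N <= j)%N -> - eps < x j) ->
  (forall j, x j < 0 -> exists k, x k < x j) ->
  forall j, 0 <= x j.
Proof.
move=> xlim xdesc j; rewrite leNgt; apply/negP => xj.
have [|N hN] := xlim (- x j); first by rewrite oppr_gt0.
(* The window of indices below [N + j.+1] contains [j], and beyond it every value exceeds [x j]. *)
have jN : (j < N + j.+1)%N by rewrite addnS ltnS leq_addl.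
case: (@arg_minP _ _ _ (Ordinal jN) xpredT (fun i : 'I__ => x i) isT).
move=> i _ imin.
have xi : x i < 0 by apply: le_lt_trans xj; exact: (imin (Ordinal jN)).
have [k xk] := xdesc _ xi.
have [kN|Nk] := ltnP k (N + j.+1).
  by move: xk; rewrite ltNge (imin (Ordinal kN)).
have := hN k (leq_trans (leq_addr _ _) Nk); rewrite opprK => xjk.
have := lt_trans xjk xk; rewrite ltNge.
by rewrite (imin (Ordinal jN)).
Qed.

Lemma cvgn_le {R : realType} {x y : nat -> R} {a b : R} :
  x @ \oo --> a -> y @ \oo --> b -> (forall n, x n <= y n) -> a <= b.
Proof. by move=> xa yb xy; apply: (ler_cvg_to xa yb); exact: nearW. Qed.

Section stein_solution.
Context {R : realType} {alpha beta : R} {mu : nat -> R}.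
Context (alpha_gt0 : 0 < alpha) (beta_gt0 : 0 < beta).
Context (mu_gt0 : forall n, 0 < mu n).
Context (mu_balance :
  forall n, pbd_death beta n.+1 * mu n.+1 = alpha * mu n).
Context (mu_sum : series mu @ \oo --> (1 : R)).
Local Notation D := (pbd_death beta).

(** * Death rates and their increments *)

Lemma pbd_deathS n : D n.+1 = n.+1%:R * (beta + n%:R).
Proof. by rewrite /pbd_death -natr1; ring. Qed.

Lemma pbd_death0 : D 0 = 0.
Proof. by rewrite /pbd_death; ring. Qed.

Lemma pbd_deathD n : D n.+1 = D n + (beta + 2 * n%:R).
Proof. by rewrite /pbd_death -natr1; ring. Qed.

Lemma pbd_deathS_gt0 n : 0 < D n.+1.
Proof. by rewrite pbd_deathS mulr_gt0 ?ltr0n// ltr_wpDr. Qed.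

Lemma pbd_death_ge0 n : 0 <= D n.
Proof. by case: n => [|n]; rewrite ?pbd_death0// ltW// pbd_deathS_gt0. Qed.

Lemma pbd_death_nd m n : (m <= n)%N -> D m <= D n.
Proof.
move/subnK <-; elim: (n - m)%N => [|k ih]; first by rewrite add0n.
by rewrite addSn pbd_deathD; apply: le_trans ih _; rewrite lerDl addr_ge0// ltW.
Qed.

(* [hmass], [tmass], [hratio], [tratio] are F, 1 - F, u, v of the introduction;
   below, [tail_coef], [head_coef] are H, L and [stein_sol f i] is -g(i+1). *)
Definition hmass n : R := series mu n.+1.
Definition tmass n : R := 1 - hmass n.
Definition hratio n : R := hmass n / (alpha * mu n).
Definition tratio n : R := tmass n / (alpha * mu n).

Lemma hmassS n : hmass n.+1 = hmass n + mu n.+1.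
Proof. by rewrite /hmass /series/= big_nat_recr. Qed.

Lemma hmass0 : hmass 0 = mu 0%N.
Proof. by rewrite /hmass /series/= big_nat1. Qed.

Lemma tmassS n : tmass n = tmass n.+1 + mu n.+1.
Proof. by rewrite /tmass hmassS; ring. Qed.

Lemma hmass_ge0 n : 0 <= hmass n.
Proof. by apply: sumr_ge0 => i _; exact: ltW. Qed.

Lemma hmass_cvg : hmass @ \oo --> (1 : R).
Proof. by rewrite /hmass (cvg_shiftS (series mu)). Qed.

Lemma mu_cvg : mu @ \oo --> (0 : R).
Proof. by apply: cvg_series_cvg_0; apply/cvg_ex; exists 1. Qed.

Lemma tmass_ge0 n : 0 <= tmass n.
Proof.
rewrite subr_ge0 /hmass -(cvg_lim (@Rhausdorff R) mu_sum).
apply: (@nondecreasing_cvgn_le _ (series mu)); last by apply/cvg_ex; exists 1.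
by apply: nondecreasing_series => k _ _; exact: ltW.
Qed.

Lemma mu_neq0 n : mu n != 0. Proof. by rewrite gt_eqF. Qed.
Let alpha_neq0 : alpha != 0. Proof. by rewrite gt_eqF. Qed.

(** * Recursions, monotonicity and convexity of the two ratios *)

Lemma alpha_hratio n : alpha * hratio n = hmass n / mu n.
Proof. by rewrite /hratio; field; rewrite alpha_neq0 mu_neq0. Qed.

Lemma alpha_tratio n : alpha * tratio n = tmass n / mu n.
Proof. by rewrite /tratio; field; rewrite alpha_neq0 mu_neq0. Qed.

Lemma tmassE n : tmass n = alpha * tratio n * mu n.
Proof. by rewrite alpha_tratio divfK ?mu_neq0. Qed.

Lemma death_div n : D n.+1 = alpha * mu n / mu n.+1.
Proof. by rewrite -mu_balance mulfK ?mu_neq0. Qed.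

(** Together with [tratioS]: both ratios obey the recursion alpha x(n+1) = D(n+1) x(n) up to a
    source, +1 for u and -1 for v. *)
Lemma hratioS n : alpha * hratio n.+1 = 1 + D n.+1 * hratio n.
Proof.
rewrite alpha_hratio hmassS death_div /hratio; field.
by rewrite alpha_neq0 !mu_neq0.
Qed.

Lemma hratio0 : alpha * hratio 0 = 1.
Proof. by rewrite alpha_hratio hmass0 divff ?mu_neq0. Qed.

Lemma tratioS n : D n.+1 * tratio n = 1 + alpha * tratio n.+1.
Proof.
rewrite alpha_tratio death_div /tratio tmassS; field.
by rewrite alpha_neq0 !mu_neq0.
Qed.

Lemma hmass_tratio n : hmass n * tratio n = tmass n * hratio n.
Proof. by rewrite /hratio /tratio; ring. Qed.

Lemma hratio_ge0 n : 0 <= hratio n.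
Proof. by rewrite divr_ge0 ?hmass_ge0// ltW// mulr_gt0. Qed.

Lemma tratio_ge0 n : 0 <= tratio n.
Proof. by rewrite divr_ge0 ?tmass_ge0// ltW// mulr_gt0. Qed.

Lemma hratio_nd n : hratio n <= hratio n.+1.
Proof.
rewrite -(ler_pM2l alpha_gt0); elim: n => [|n ih].
  by rewrite hratioS hratio0 lerDl mulr_ge0 ?hratio_ge0 ?pbd_death_ge0.
rewrite [leLHS]hratioS [leRHS]hratioS lerD2l ler_pM ?hratio_ge0 ?pbd_death_ge0//.
  exact: pbd_death_nd.
by rewrite -(ler_pM2l alpha_gt0).
Qed.

(** Induction through the discrete Leibniz rule: the second difference of D u is a sum of
    nonnegative terms in the second difference of u, its increment and u itself, since D has second
    difference 2. *)
Lemma hratio_convex n : 0 <= hratio n.+2 - 2 * hratio n.+1 + hratio n.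
Proof.
rewrite -(pmulr_rge0 _ alpha_gt0); elim: n => [|n ih].
  have -> : alpha * (hratio 2 - 2 * hratio 1 + hratio 0) =
      alpha * hratio 2 - 2 * (alpha * hratio 1) + alpha * hratio 0 by ring.
  rewrite !hratioS hratio0; have := hratio_nd 0; have := hratio_ge0 0.
  have := pbd_death_ge0 2; rewrite !pbd_deathD pbd_death0 => d u0 u1.
  have : 0 <= (beta + 1) * (hratio 1 - hratio 0).
    by rewrite mulr_ge0 ?subr_ge0// addr_ge0// ltW.
  by nra.
have -> : alpha * (hratio n.+3 - 2 * hratio n.+2 + hratio n.+1) =
  alpha * hratio n.+3 - 2 * (alpha * hratio n.+2) + alpha * hratio n.+1 by ring.
rewrite !(hratioS, pbd_deathD n.+1, pbd_deathD n.+2).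
rewrite pmulr_rge0 // in ih.
have := mulr_ge0 (pbd_death_ge0 n.+3) ih; rewrite !pbd_deathD -!natr1.
have := hratio_nd n; have := hratio_ge0 n => u0.
rewrite -subr_ge0 => u1.
have : 0 <= (beta + 2 * (n%:R + 1)) * (hratio n.+1 - hratio n).
  by rewrite mulr_ge0// addr_ge0 ?ltW// mulr_ge0// addr_ge0.
by nra.
Qed.

(** By balance mu(k+1) / mu(k) = alpha / D(k+1), and D is nondecreasing. *)
Lemma mu_log_concave m n : (m <= n)%N -> mu n.+1 * mu m <= mu n * mu m.+1.
Proof.
move=> mn; rewrite -(ler_pM2l alpha_gt0).
have -> : alpha * (mu n.+1 * mu m) = D m.+1 * (mu n.+1 * mu m.+1).
  by rewrite mulrCA -mu_balance mulrCA.
rewrite [leRHS]mulrA -mu_balance -mulrA ler_wpM2r ?pbd_death_nd//.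
by rewrite mulr_ge0// ltW.
Qed.

(** Up to the factor alpha, v(n) is the sum over j >= 1 of mu(n+j) / mu(n); log-concavity makes each
    term nonincreasing in n. The comparison is made on partial sums and passed to the limit. *)
Lemma tratio_ni n : tratio n.+1 <= tratio n.
Proof.
have fin N : (hmass (N + n).+1 - hmass n.+1) * mu n <=
    (hmass (N + n) - hmass n) * mu n.+1.
  elim: N => [|N ih]; first by rewrite add0n !subrr !mul0r.
  rewrite addSn hmassS [hmass (N + n).+1 in leRHS]hmassS !(addrAC _ _ (- _)).
  by rewrite mulrDl [leRHS]mulrDl lerD// mu_log_concave// leqW// leq_addl.
have : tmass n.+1 * mu n <= tmass n * mu n.+1.
  apply: (cvgn_le _ _ fin); apply: cvgM; try exact: cvg_cst.
    apply: cvgB; last exact: cvg_cst.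
    rewrite (cvg_shiftn n (fun N => hmass N.+1)) (cvg_shiftS hmass).
    exact: hmass_cvg.
  apply: cvgB; last exact: cvg_cst.
  by rewrite (cvg_shiftn n hmass); exact: hmass_cvg.
rewrite /tratio !invfM !mulrA ler_pdivrMr// mulrAC ler_pdivlMr// => h.
by rewrite -!(mulrAC _ _ alpha^-1) ler_wpM2r// invr_ge0 ltW.
Qed.

Lemma tratio_le n : tratio n <= tratio 0.
Proof. by elim: n => // n; apply: le_trans; exact: tratio_ni. Qed.

Lemma death_tratio_ni n : D n.+2 * tratio n.+1 <= D n.+1 * tratio n.
Proof. by rewrite !tratioS lerD2l ler_pM2l// tratio_ni. Qed.

(** Since D(k+1) v(k) is nonincreasing, D(n+2) (v(n+1) - v(n+2)) >= (beta + 2(n+2)) v(n+2); and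
    D(n+2) is at most the product of the increments of D on either side of n+2. *)
Lemma tratio_log_slope n :
  tratio n.+2 <= (beta + 2 * n.+1%:R) * (tratio n.+1 - tratio n.+2).
Proof.
rewrite -(ler_pM2l (pbd_deathS_gt0 n.+1)).
have := death_tratio_ni n.+1; rewrite (pbd_deathD n.+2) => h.
have K0 : 0 <= beta + 2 * n.+1%:R by rewrite addr_ge0 ?ltW// mulr_ge0.
have {h}: 0 <= (beta + 2 * n.+1%:R) *
    (D n.+2 * tratio n.+1 - (D n.+2 + (beta + 2 * n.+2%:R)) * tratio n.+2).
  by rewrite mulr_ge0// subr_ge0.
suff : 0 <= ((beta + 2 * n.+1%:R) * (beta + 2 * n.+2%:R) - D n.+2) * tratio n.+2.
  by lra.
rewrite mulr_ge0 ?tratio_ge0// pbd_deathS -!natr1.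
have n0 : (0 : R) <= n%:R by [].
have b0 := ltW beta_gt0.
have := mulr_ge0 n0 b0; have := mulr_ge0 n0 n0; have := mulr_ge0 b0 b0.
by lra.
Qed.

(** With q the second difference of v, mu q is nonincreasing and bounded below by a multiple of mu,
    which tends to 0; hence mu q >= 0. *)
Lemma tratio_convex n : 0 <= tratio n - 2 * tratio n.+1 + tratio n.+2.
Proof.
pose q k := tratio k - 2 * tratio k.+1 + tratio k.+2.
(* By balance this says alpha q(k+1) <= D(k+1) q(k). Expanding with [tratioS], the gap is 2 K
   (v(k+1) - v(k+2)) - 2 v(k+2) with K = D(k+2) - D(k+1). *)
have step k : mu k.+1 * q k.+1 <= mu k * q k.
  rewrite -(ler_pM2l alpha_gt0) [leRHS]mulrA -mu_balance mulrCA.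
  rewrite -mulrA [leRHS]mulrCA ler_pM2l// /q.
  have := tratio_log_slope k.
  have := tratioS k; have := tratioS k.+1; have := tratioS k.+2.
  rewrite (pbd_deathD k.+2) (pbd_deathD k.+1) -!natr1.
  by lra.
have chain N : mu (N + n) * q (N + n) <= mu n * q n.
  by elim: N => // N ih; rewrite addSn; apply: le_trans (step _) ih.
have : 0 <= mu n * q n.
  have fin N : - 2 * tratio 0 * mu (N + n) <= mu n * q n.
    apply: le_trans (chain N); rewrite mulrC ler_pM2l// /q.
    have := tratio_le (N + n).+1; have := tratio_ge0 (N + n).
    by have := tratio_ge0 (N + n).+2; lra.
  apply: (cvgn_le _ _ fin); last exact: cvg_cst.
  rewrite -[X in _ --> X](mulr0 (- 2 * tratio 0)); apply: cvgM.
    exact: cvg_cst.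
  by rewrite (cvg_shiftn n mu); exact: mu_cvg.
by rewrite pmulr_rge0.
Qed.

Lemma tmass_le n : tmass n <= alpha * tratio 0 * mu n.
Proof. by rewrite tmassE ler_pM2r// ler_pM2l// tratio_le. Qed.

Lemma tmass_series_cvg : cvgn (series tmass).
Proof.
apply: (series_le_cvg (v_ := fun n => alpha * tratio 0 * mu n)).
- exact: tmass_ge0.
- by move=> n; apply: le_trans (tmass_ge0 n) (tmass_le n).
- exact: tmass_le.
- by apply: is_cvg_seriesZ; apply/cvg_ex; exists 1.
Qed.

(** * The solution of the Stein equation by summation by parts *)

Definition fdiff (f : nat -> R) k := f k.+1 - f k.
Definition head_coef f i := \sum_(0 <= k < i) fdiff f k * hmass k.
Definition tail_sums f := series (fun k => fdiff f k * tmass k).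
Definition tail_coef f i := limn (tail_sums f) - tail_sums f i.
(** This is pi(f) after summation by parts; [stein_mean_cvg] identifies it with the sum of f against
    [mu]. *)
Definition stein_mean (f : nat -> R) := f 0%N + limn (tail_sums f).
Definition stein_sol f i :=
  tail_coef f i * hratio i + head_coef f i * tratio i.

Lemma head_coefS f i :
  head_coef f i.+1 = head_coef f i + fdiff f i * hmass i.
Proof. by rewrite /head_coef big_nat_recr. Qed.

Lemma tail_coefS f i :
  tail_coef f i = tail_coef f i.+1 + fdiff f i * tmass i.
Proof. by rewrite /tail_coef /tail_sums /series/= big_nat_recr//=; ring. Qed.

Lemma coef_diff f i : tail_coef f i - head_coef f i = stein_mean f - f i.
Proof.
elim: i => [|i ih].
  rewrite /tail_coef /head_coef /tail_sums /series/= !big_geq// /stein_mean.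
  by ring.
move: ih; rewrite tail_coefS head_coefS /fdiff /tmass => ih.
by rewrite -[LHS]addrC; lra.
Qed.

Lemma stein_sol0 f : alpha * stein_sol f 0 = stein_mean f - f 0%N.
Proof.
rewrite /stein_sol -coef_diff mulrDr mulrCA hratio0.
by rewrite /head_coef big_geq// mul0r mulr0 subr0 mulr1 addr0.
Qed.

(** The sources +1 and -1 of the two recursions produce [tail_coef - head_coef], known from
    [coef_diff]. The increment that passes from tail to head contributes equally on both sides
    because F v = (1 - F) u. *)
Lemma stein_solS f i :
  alpha * stein_sol f i.+1 = D i.+1 * stein_sol f i + stein_mean f - f i.+1.
Proof.
rewrite -addrA -coef_diff /stein_sol (tail_coefS f i) (head_coefS f i).
have hu := hratioS i; have hv := tratioS i; have huv := hmass_tratio i.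
have -> : alpha * (tail_coef f i.+1 * hratio i.+1 +
    (head_coef f i + fdiff f i * hmass i) * tratio i.+1) =
    tail_coef f i.+1 * (alpha * hratio i.+1) +
    (head_coef f i + fdiff f i * hmass i) * (alpha * tratio i.+1) by ring.
rewrite hu (_ : alpha * tratio i.+1 = D i.+1 * tratio i - 1); last first.
  by rewrite hv; ring.
have -> : (tail_coef f i.+1 + fdiff f i * tmass i) * hratio i =
   tail_coef f i.+1 * hratio i + fdiff f i * (hmass i * tratio i).
  by rewrite huv; ring.
by ring.
Qed.

(** * Domination by the identity, whose increments are extremal *)

Local Notation idr := (fun k : nat => k%:R : R).

Lemma fdiff_id k : fdiff idr k = 1.
Proof. by rewrite /fdiff -natr1; ring. Qed.

Lemma tail_sums_id : tail_sums idr = series tmass.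
Proof. by rewrite /tail_sums; under eq_fun do rewrite fdiff_id mul1r. Qed.

Section lipschitz_data.
Context (f : nat -> R) (f_lip : forall k, `|fdiff f k| <= 1).

Lemma tail_sums_cvg : cvgn (tail_sums f).
Proof.
apply: normed_cvg; apply: series_le_cvg tmass_series_cvg => n /=.
- exact: normr_ge0.
- exact: tmass_ge0.
by rewrite normrM (ger0_norm (tmass_ge0 _)) ler_piMl ?tmass_ge0.
Qed.

Lemma head_coef_le i : `|head_coef f i| <= head_coef idr i.
Proof.
apply: le_trans (ler_norm_sum _ _ _) _; apply: ler_sum => k _.
by rewrite normrM (ger0_norm (hmass_ge0 _)) fdiff_id ler_wpM2r ?hmass_ge0.
Qed.

Lemma tail_sums_sub_le N i :
  `|tail_sums f (N + i)%N - tail_sums f i| <=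
  tail_sums idr (N + i)%N - tail_sums idr i.
Proof.
elim: N => [|N ih]; first by rewrite add0n !subrr normr0.
rewrite addSn /tail_sums /series/= !big_nat_recr//= -/(tail_sums f _).
rewrite !(addrAC _ (_ * tmass _)); apply: le_trans (ler_normD _ _) _.
apply: lerD => //.
by rewrite normrM (ger0_norm (tmass_ge0 _)) fdiff_id ler_wpM2r ?tmass_ge0.
Qed.

End lipschitz_data.

Lemma fdiff_id_lip k : `|fdiff idr k| <= 1.
Proof. by rewrite fdiff_id normr1. Qed.

Lemma tail_coef_le f : (forall k, `|fdiff f k| <= 1) ->
  forall i, `|tail_coef f i| <= tail_coef idr i.
Proof.
move=> f_lip i; apply: (cvgn_le _ _ (tail_sums_sub_le f f_lip ^~ i)).
  apply: cvg_norm; apply: cvgB; last exact: cvg_cst.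
  by rewrite (cvg_shiftn i (tail_sums f)); exact: tail_sums_cvg.
apply: cvgB; last exact: cvg_cst.
by rewrite (cvg_shiftn i (tail_sums idr)); exact: tail_sums_cvg fdiff_id_lip.
Qed.

Local Notation e := (stein_sol idr).

Lemma head_coef_id_ge0 i : 0 <= head_coef idr i.
Proof. exact: le_trans (head_coef_le idr fdiff_id_lip i). Qed.

Lemma tail_coef_id_ge0 i : 0 <= tail_coef idr i.
Proof. exact: le_trans (tail_coef_le idr fdiff_id_lip i). Qed.

Lemma stein_sol_id_ge0 i : 0 <= e i.
Proof.
rewrite addr_ge0// mulr_ge0 ?hratio_ge0 ?tratio_ge0//.
- exact: tail_coef_id_ge0.
- exact: head_coef_id_ge0.
Qed.

Lemma stein_sol_le f : (forall k, `|fdiff f k| <= 1) ->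
  forall i, `|stein_sol f i| <= e i.
Proof.
move=> f_lip i; rewrite /stein_sol; apply: le_trans (ler_normD _ _) _.
rewrite (normrM (tail_coef f i)) (normrM (head_coef f i)).
rewrite (ger0_norm (hratio_ge0 i)) (ger0_norm (tratio_ge0 i)).
apply: lerD; rewrite ler_wpM2r ?hratio_ge0 ?tratio_ge0//.
- exact: tail_coef_le.
- exact: head_coef_le.
Qed.

(** * Decay and increments of the solution for the identity *)

Lemma head_coef_id_le i : head_coef idr i <= i%:R.
Proof.
elim: i => [|i ih]; first by rewrite /head_coef big_geq.
rewrite head_coefS fdiff_id mul1r -natr1 lerD//.
by rewrite -subr_ge0; exact: tmass_ge0.
Qed.

(** The tail sums 1 - F(k) = alpha v(k) mu(k) over k >= i; there v(k) <= v(i), and the mass of [i,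
    oo) is mu(i) (1 + alpha v(i)). *)
Lemma tail_coef_id_le i :
  tail_coef idr i <= alpha * tratio i * (mu i * (1 + alpha * tratio i)).
Proof.
have tratio_i N : tratio (N + i) <= tratio i.
  by elim: N => // N; apply: le_trans; exact: tratio_ni.
rewrite /tail_coef; have := tail_sums_cvg idr fdiff_id_lip.
rewrite tail_sums_id => cvg_tmass.
have fin N : series tmass (N + i)%N - series tmass i <=
    alpha * tratio i * (series mu (N + i)%N - series mu i).
  elim: N => [|N ih]; first by rewrite add0n !subrr mulr0.
  have sS x : series x (N.+1 + i)%N = series x (N + i)%N + x (N + i)%N :> R.
    by rewrite addSn /series/= big_nat_recr.
  rewrite !sS [leRHS]mulrBr mulrDr [leRHS]addrAC -mulrBr addrAC lerD//.
  by rewrite tmassE ler_pM2r// ler_pM2l.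
have mass_i : mu i * (1 + alpha * tratio i) = 1 - series mu i.
  rewrite mulrDr mulr1 mulrC -tmassE /tmass /hmass /series/= big_nat_recr//=.
  by ring.
rewrite mass_i; apply: (cvgn_le _ _ fin).
  apply: cvgB; last exact: cvg_cst.
  by rewrite (cvg_shiftn i (series tmass)).
apply: cvgM; first exact: cvg_cst.
apply: cvgB; last exact: cvg_cst.
by rewrite (cvg_shiftn i (series mu)).
Qed.

(** With c = 1 + alpha v(0), e(i) <= v(i) (c + i), while D(i+1) v(i) <= c and c + i <= c (i + 1). *)
Lemma stein_sol_id_decay i :
  e i * (beta + i%:R) <= (1 + alpha * tratio 0) ^+ 2.
Proof.
set c := 1 + alpha * tratio 0.
have c1 : 1 <= c by rewrite lerDl mulr_ge0 ?tratio_ge0// ltW.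
have v0 := tratio_ge0 i.
have vc j : 1 + alpha * tratio j <= c by rewrite lerD2l ler_pM2l// tratio_le.
have m0 := mu_gt0 i.
have ei : e i <= tratio i * (c + i%:R).
  rewrite mulrDr lerD//; last first.
    by rewrite mulrC ler_wpM2l// head_coef_id_le.
  apply: (@le_trans _ _ (tratio i * (1 + alpha * tratio i))); last first.
    by rewrite ler_wpM2l.
  apply: (@le_trans _ _
    (alpha * tratio i * (mu i * (1 + alpha * tratio i)) * (alpha * mu i)^-1)).
    apply: ler_pM; rewrite ?tail_coef_id_ge0 ?hratio_ge0 ?tail_coef_id_le//.
    rewrite /hratio ler_piMl ?invr_ge0 ?mulr_ge0 ?(ltW alpha_gt0) ?(ltW m0)//.
    by rewrite -subr_ge0; exact: tmass_ge0.
  rewrite le_eqVlt; apply/orP; left; apply/eqP; field.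
  by rewrite mu_neq0 alpha_neq0.
have bi : 0 <= beta + i%:R by rewrite addr_ge0 ?(ltW beta_gt0).
have := ler_wpM2r bi ei => /le_trans; apply.
rewrite -(@ler_pM2r _ i.+1%:R) ?ltr0n//.
have -> : tratio i * (c + i%:R) * (beta + i%:R) * i.+1%:R =
   D i.+1 * tratio i * (c + i%:R) by rewrite pbd_deathS; ring.
rewrite tratioS expr2 -mulrA; apply: ler_pM => //.
- by rewrite addr_ge0// mulr_ge0 ?tratio_ge0// ltW.
- by rewrite addr_ge0// (le_trans _ c1).
- by rewrite -natr1 mulrDr mulr1 addrC lerD2r ler_peMl.
Qed.

Lemma stein_sol_id_small eps : 0 < eps ->
  exists N, forall j, (N <= j)%N -> e j < eps.
Proof.
move=> eps0; set K := (1 + alpha * tratio 0) ^+ 2.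
exists (Num.bound (K / eps)) => j Nj.
have bj : 0 < beta + j%:R by rewrite ltr_wpDr.
rewrite -(ltr_pM2r bj); apply: le_lt_trans (stein_sol_id_decay j) _.
rewrite -ltr_pdivrMl// mulrC; apply: le_lt_trans (ler_norm _) _.
apply: lt_le_trans (archi_boundP _) _ => //.
rewrite (@le_trans _ _ j%:R) ?ler_nat ?lerDr ?(ltW beta_gt0)//.
rewrite ger0_norm// divr_ge0 ?(ltW eps0)// exprn_ge0// addr_ge0//.
by rewrite mulr_ge0 ?tratio_ge0// ltW.
Qed.

(** For a(j) = e(j) - e(j+1), differencing the recursion gives alpha (a(j) - a(j+1)) = D(j) (a(j-1)
    - a(j)) - 2 K a(j) + 2 e(j+1) with K = D(j+1) - D(j) > 0; the term with D(j) drops out at j = 0.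
    If a(j) < 0 lies below both neighbours, the right side is positive and the left is not. *)
Lemma stein_sol_id_ni j : e j.+1 <= e j.
Proof.
rewrite -subr_ge0; move: j; apply: minimum_principle => [eps eps0|j].
  have [N hN] := stein_sol_id_small _ eps0; exists N => j Nj.
  by have := hN _ (leqW Nj); have := stein_sol_id_ge0 j; lra.
move=> aj.
have [a1|a1] := ltP (e j.+1 - e j.+2) (e j - e j.+1); first by exists j.+1.
have {a1} h1 := ler_wpM2l (ltW alpha_gt0) a1.
have e0 := stein_sol_id_ge0 j.+1.
have := stein_solS idr j; have := stein_solS idr j.+1; rewrite -!natr1.
case: j aj h1 e0 => [|i] aj h1 e0.
  have := stein_sol0 idr; rewrite !pbd_deathD pbd_death0 => E0 E2 E1.
  have : 0 < beta * (e 1 - e 0) by rewrite mulr_gt0//; lra.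
  (* The hypotheses already conflict, so the witness is arbitrary. *)
  by exists 0%N; lra.
have [a2|a2] := ltP (e i - e i.+1) (e i.+1 - e i.+2); first by exists i.
have := stein_solS idr i.
rewrite !(pbd_deathD i.+2) !(pbd_deathD i.+1) -!natr1 => E0 E2 E1.
have {a2} := ler_wpM2l (pbd_death_ge0 i.+1) a2.
have : 0 < (beta + 2 * (i%:R + 1)) * (e i.+2 - e i.+1).
  rewrite mulr_gt0//; last by lra.
  by rewrite ltr_pwDl// mulr_ge0// addr_ge0.
by exists 0%N; lra.
Qed.

(** The minimum principle for 1 - alpha a(j): it is eventually positive because e tends to 0, and at
    j = 0 it equals D(1) e(0). *)
Lemma stein_sol_id_slope j : alpha * (e j - e j.+1) <= 1.
Proof.
rewrite -subr_ge0; move: j; apply: minimum_principle => [eps eps0|j].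
  have [|N hN] := stein_sol_id_small alpha^-1; first by rewrite invr_gt0.
  exists N => j /hN; rewrite -(ltr_pM2l alpha_gt0) mulfV// => h.
  by have := mulr_ge0 (ltW alpha_gt0) (stein_sol_id_ge0 j.+1); lra.
case: j => [|i].
  have := stein_solS idr 0; have := stein_sol0 idr => E0 E1.
  by have := mulr_ge0 (pbd_death_ge0 1) (stein_sol_id_ge0 0); lra.
set a := fun j => e j - e j.+1; rewrite -/(a i.+1) => b1.
have [h|b0] := ltP (1 - alpha * a i) (1 - alpha * a i.+1); first by exists i.
have [h|b2] := ltP (1 - alpha * a i.+2) (1 - alpha * a i.+1); first by exists i.+2.
set k := beta + 2 * i.+1%:R.
have k0 : 0 < k by rewrite ltr_pwDl.
have E0 := stein_solS idr i; have E1 := stein_solS idr i.+1.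
have E2 := stein_solS idr i.+2.
have D2 : D i.+2 = D i.+1 + k by rewrite pbd_deathD.
have D3 : D i.+3 = D i.+1 + 2 * k + 2 by rewrite pbd_deathD D2 /k -!natr1; ring.
have B1 : 1 - alpha * a i.+1 = k * e i.+1 - D i.+1 * a i.
  by rewrite /a; move: E0 E1; rewrite D2 -!natr1; lra.
have B2 : 1 - alpha * a i.+2 = (k + 2) * e i.+1 - D i.+3 * a i.+1.
  by rewrite /a; move: E1 E2; rewrite D2 D3 -!natr1; lra.
have a01 : a i <= a i.+1 by rewrite -(ler_pM2l alpha_gt0); lra.
have a1 : 0 < a i.+1 by rewrite -(pmulr_rgt0 _ alpha_gt0); lra.
have D1k : D i.+1 <= k ^+ 2.
  have aux (x b : R) : 0 <= x -> 0 < b ->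
      (x + 1) * (b + x) <= (b + 2 * (x + 1)) ^+ 2.
    by nra.
  by rewrite pbd_deathS /k -[i.+1%:R]natr1 aux.
have h1 := ler_wpM2l (ltW k0) b2.
have h2 : (k + 2) * D i.+1 * a i <= (k + 2) * D i.+1 * a i.+1.
  by rewrite ler_wpM2l// mulr_ge0 ?pbd_death_ge0// addr_ge0 ?ltW.
have h3 : (D i.+1 - k ^+ 2) * a i.+1 <= 0.
  by rewrite mulr_le0_ge0 ?subr_le0// ltW.
have h4 := mulr_gt0 k0 a1.
(* Eliminating e(i+1) between [B1] and [B2] gives (k+2) B1 - k B2 = k D(i+3) a(i+1) - (k+2) D(i+1)
   a(i). The left side is negative at a negative minimum; the right is at least 2 (k^2 - D(i+1) + k)
   a(i+1) > 0. *)
exfalso; move: h1 b1; rewrite B1 B2 D3 => h1 b1; nra.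
Qed.

Lemma stein_sol_second_diff f : (forall k, `|fdiff f k| <= 1) ->
  forall m, alpha *
    `|stein_sol f m.+2 - 2 * stein_sol f m.+1 + stein_sol f m| <= 3.
Proof.
move=> f_lip m.
pose U := hratio m.+2 - 2 * hratio m.+1 + hratio m.
pose V := tratio m - 2 * tratio m.+1 + tratio m.+2.
pose N := tmass m.+1 * (2 * hratio m.+1 - hratio m) - hmass m.+1 * tratio m.+2.
have decomp h : stein_sol h m.+2 - 2 * stein_sol h m.+1 + stein_sol h m =
    tail_coef h m.+2 * U + head_coef h m.+1 * V - fdiff h m.+1 * N.
  rewrite /stein_sol /U /V /N (tail_coefS h m) (tail_coefS h m.+1).
  rewrite (head_coefS h m.+1) (head_coefS h m).
  apply/eqP; rewrite -subr_eq0; apply/eqP.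
  (* The increment at m drops out because F v = (1 - F) u. *)
  transitivity (fdiff h m * (tmass m * hratio m - hmass m * tratio m)).
    by ring.
  by rewrite hmass_tratio subrr mulr0.
have U0 : 0 <= U by exact: hratio_convex.
have V0 : 0 <= V by exact: tratio_convex.
have N0 : 0 <= N.
  have -> : N = tmass m.+1 * (hratio m.+1 - hratio m) +
      hmass m.+1 * (tratio m.+1 - tratio m.+2).
    by have := hmass_tratio m.+1; rewrite /N; lra.
  rewrite addr_ge0// mulr_ge0 ?tmass_ge0 ?hmass_ge0// subr_ge0.
  - exact: hratio_nd.
  - exact: tratio_ni.
have N1 : alpha * N <= 1.
  have -> : alpha * N = 1 - tmass m.+1 * (alpha * U).
    have := hratioS m.+1; have := tratioS m.+1; have := hmass_tratio m.+1.
    rewrite /N /U => E1 E2 E3.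
    have E4 : hmass m.+1 * (alpha * tratio m.+2) =
        D m.+2 * (hmass m.+1 * tratio m.+1) - hmass m.+1.
      rewrite (_ : alpha * tratio m.+2 = D m.+2 * tratio m.+1 - 1); first by ring.
      by rewrite E2; ring.
    have E5 : tmass m.+1 * (alpha * hratio m.+2) =
        tmass m.+1 + D m.+2 * (tmass m.+1 * hratio m.+1) by rewrite E3; ring.
    have E6 : tmass m.+1 = 1 - hmass m.+1 by [].
    by rewrite E1 in E4; lra.
  by rewrite gerBl mulr_ge0 ?tmass_ge0// mulr_ge0// ltW.
(* The second difference is a(m) - a(m+1), with a(m) <= 1 / alpha and a(m+1) >= 0. *)
have T : e m.+2 - 2 * e m.+1 + e m <= alpha^-1.
  have := stein_sol_id_slope m; rewrite -ler_pdivlMl// mulr1.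
  by have := stein_sol_id_ni m.+1; lra.
rewrite decomp in T; rewrite decomp.
have bound :
    `|tail_coef f m.+2 * U + head_coef f m.+1 * V - fdiff f m.+1 * N| <=
    tail_coef idr m.+2 * U + head_coef idr m.+1 * V + N.
  apply: le_trans (ler_normB _ _) _; apply: lerD; last first.
    by rewrite normrM (ger0_norm N0) ler_piMl.
  apply: le_trans (ler_normD _ _) _; rewrite !normrM (ger0_norm U0) (ger0_norm V0).
  by apply: lerD; rewrite ler_wpM2r ?tail_coef_le ?head_coef_le.
have := ler_wpM2l (ltW alpha_gt0) bound => /le_trans; apply.
rewrite -(ler_pM2l alpha_gt0) mulfV// fdiff_id in T.
by lra.
Qed.

(** * Identification of the mean, and the Stein equation *)

Lemma stein_partial_sum f N : \sum_(0 <= k < N.+1) (f k - stein_mean f) * mu k =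
  - (alpha * mu N * stein_sol f N).
Proof.
elim: N => [|N ih].
  by rewrite big_nat1 mulrAC stein_sol0 -mulNr opprB.
(* Balance turns alpha mu(N) into D(N+1) mu(N+1), so that the sum telescopes. *)
rewrite big_nat_recr//= ih -mu_balance.
have -> : alpha * mu N.+1 * stein_sol f N.+1 =
    mu N.+1 * (alpha * stein_sol f N.+1).
  by ring.
by rewrite stein_solS; ring.
Qed.

(** The boundary term of [stein_partial_sum] vanishes in the limit: the solution is bounded by e(0)
    and mu tends to 0. *)
Lemma stein_mean_cvg f : (forall k, `|fdiff f k| <= 1) ->
  series (fun k => f k * mu k) @ \oo --> stein_mean f.
Proof.
move=> f_lip; rewrite -(cvg_shiftS (series _)).
have -> : (fun N => series (fun k => f k * mu k) N.+1) =
    (fun N => stein_mean f * hmass N - alpha * mu N * stein_sol f N).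
  apply/funext => N.
  rewrite -stein_partial_sum /hmass /series/= mulr_sumr -big_split/=.
  by apply: eq_bigr => k _; ring.
have hmass_lim : (fun N => stein_mean f * hmass N) @ \oo --> stein_mean f * 1.
  by apply: cvgM; [exact: cvg_cst|exact: hmass_cvg].
suff sol_lim : (fun N => alpha * mu N * stein_sol f N) @ \oo --> (0 : R).
  by have h := cvgB hmass_lim sol_lim; rewrite mulr1 subr0 in h; exact: h.
have mu_lim : (fun N => alpha * e 0 * mu N) @ \oo --> (0 : R).
  have : (fun N => alpha * e 0 * mu N) @ \oo --> alpha * e 0 * 0.
    by apply: cvgM; [exact: cvg_cst|exact: mu_cvg].
  by rewrite mulr0.
apply/norm_cvg0P; apply: (squeeze_cvgr _ (@cvg_cst _ _ _ _ _) mu_lim).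
apply: nearW => N; rewrite normr_ge0/= normrM ger0_norm; last first.
  by rewrite mulr_ge0// ltW.
rewrite mulrAC ler_wpM2r ?(ltW (mu_gt0 _))// ler_pM2l//.
apply: le_trans (stein_sol_le f f_lip N) _.
by elim: N => // N; apply: le_trans; exact: stein_sol_id_ni.
Qed.

(* The value at 0 is immaterial because [D 0 = 0]. *)
Definition stein_fun f k := - stein_sol f k.-1.

Lemma stein_equation f k :
  alpha * stein_fun f k.+1 - D k * stein_fun f k = f k - stein_mean f.
Proof.
rewrite /stein_fun; case: k => [|k] /=.
  by rewrite pbd_death0 mulrN stein_sol0; ring.
by rewrite mulrN stein_solS; ring.
Qed.

Lemma stein_fun_second_diff f : (forall k, `|fdiff f k| <= 1) -> forall k,
  `|stein_fun f k.+3 - 2 * stein_fun f k.+2 + stein_fun f k.+1| <= 3 / alpha.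
Proof.
move=> f_lip k; rewrite ler_pdivlMr// mulrC /stein_fun/=.
apply: le_trans (stein_sol_second_diff f f_lip k).
by rewrite -normrN le_eqVlt; apply/orP; left; apply/eqP; congr (_ * `|_|); ring.
Qed.

End stein_solution.

(** * Generating functions of sums of Bernoulli variables *)

Section pairing.
Context {R : realType}.
Implicit Types (q r : {poly R}) (phi : nat -> R).

(** For q the generating function of W this is E phi(W). Multiplication by X, X d/dX and
    multiplication by X - 1 become a shift, multiplication by k and a forward difference of phi. *)
Definition pairing q phi : R := \sum_(k < size q) q`_k * phi k.

Lemma pairingE N q phi : (size q <= N)%N ->
  pairing q phi = \sum_(k < N) q`_k * phi k.
Proof.
move=> qN; rewrite /pairing (big_ord_widen _ (fun k => q`_k * phi k) qN).
rewrite big_mkcond/=; apply: eq_bigr => k _; case: ltnP => // h.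
by rewrite nth_default// mul0r.
Qed.

Lemma pairing_is_linear phi a q r :
  pairing (a *: q + r) phi = a * pairing q phi + pairing r phi.
Proof.
pose N := maxn (size (a *: q + r)) (maxn (size q) (size r)).
rewrite !(@pairingE N) ?leq_max ?leqnn ?orbT// mulr_sumr -big_split/=.
by apply: eq_bigr => k _; rewrite coefD coefZ; ring.
Qed.

Lemma pairingD q r phi : pairing (q + r) phi = pairing q phi + pairing r phi.
Proof. by rewrite -[q]scale1r pairing_is_linear mul1r scale1r. Qed.

Lemma pairing0 phi : pairing 0 phi = 0.
Proof. by rewrite /pairing size_poly0 big_ord0. Qed.

Lemma pairingZ a q phi : pairing (a%:P * q) phi = a * pairing q phi.
Proof. by rewrite mul_polyC -[_ *: _]addr0 pairing_is_linear pairing0 addr0. Qed.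

Lemma pairingN q phi : pairing (- q) phi = - pairing q phi.
Proof. by rewrite -mulN1r -polyCN pairingZ mulN1r. Qed.

Lemma pairing_sum (I : finType) (P : pred I) (F : I -> {poly R}) phi :
  pairing (\sum_(i | P i) F i) phi = \sum_(i | P i) pairing (F i) phi.
Proof.
by apply: (big_morph (pairing^~ phi)) => [q r|]; [exact: pairingD|exact: pairing0].
Qed.

Lemma pairingX q phi : pairing (q * 'X) phi = pairing q (fun k => phi k.+1).
Proof.
have [->|q0] := eqVneq q 0; first by rewrite mul0r !pairing0.
rewrite /pairing size_mulX// big_ord_recl coefMX mul0r add0r.
by apply: eq_bigr => k _; rewrite coefMX.
Qed.

Lemma pairing_deriv q phi :
  pairing (q^`() * 'X) phi = pairing q (fun k => k%:R * phi k).
Proof.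
rewrite (@pairingE (size q).+1); last first.
  apply: leq_trans (size_polyMleq _ _) _; rewrite size_polyX addn2/= ltnS.
  exact: leq_trans (size_poly _ _) (leq_pred _).
rewrite [RHS](@pairingE (size q).+1)//; apply: eq_bigr => -[[|k] /= _] _.
  by rewrite coefMX !mul0r mulr0.
by rewrite coefMX/= coef_deriv mulrA mulr_natr.
Qed.

Lemma pairing_ext q phi psi : phi =1 psi -> pairing q phi = pairing q psi.
Proof. by move=> h; apply: eq_bigr => k _; rewrite h. Qed.

Lemma pairing_linr q a b phi psi :
  pairing q (fun k => a * phi k + b * psi k) =
  a * pairing q phi + b * pairing q psi.
Proof.
by rewrite /pairing !mulr_sumr -big_split; apply: eq_bigr => k _ /=; ring.
Qed.

Lemma pairing_cst q c : pairing q (fun=> c) = q.[1] * c.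
Proof.
by rewrite horner_coef mulr_suml; apply: eq_bigr => k _; rewrite expr1n mulr1.
Qed.

Lemma pairing_diff q phi :
  pairing (q * ('X - 1)) phi = pairing q (fun k => phi k.+1 - phi k).
Proof.
rewrite mulrBr mulr1 pairingD pairingN pairingX -[RHS]/(pairing q _).
rewrite (@pairing_ext q (fun k => phi k.+1 - phi k)
  (fun k => 1 * phi k.+1 + (-1) * phi k)); last by move=> k; ring.
by rewrite pairing_linr; ring.
Qed.

Lemma pairing_cvg q phi :
  series (fun k => phi k * q`_k) @ \oo --> pairing q phi.
Proof.
apply: cvg_near_cst; exists (size q) => //= N /= qN.
rewrite (pairingE N)// /series/= big_mkord.
by apply: eq_bigr => k _; rewrite mulrC.
Qed.

Lemma pairing_bound q phi c : (forall k, 0 <= q`_k) ->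
  (forall k, `|phi k| <= c) -> `|pairing q phi| <= c * q.[1].
Proof.
move=> q0 phic; rewrite horner_coef mulr_sumr.
apply: le_trans (ler_norm_sum _ _ _) _; apply: ler_sum => k _.
by rewrite normrM (ger0_norm (q0 _)) expr1n mulr1 mulrC ler_wpM2r.
Qed.

End pairing.

Lemma deriv_prod {R : comNzRingType} {I : finType} (P : pred I)
    (F : I -> {poly R}) :
  (\prod_(i | P i) F i)^`() =
  \sum_(i | P i) (F i)^`() * \prod_(j | P j && (j != i)) F j.
Proof.
have [m] := ubnP #|P|; elim: m P => // m ih P; rewrite ltnS => Pm.
have [i0 Pi0|P0] := pickP P; last by rewrite !big_pred0// derivC.
rewrite (bigD1 i0)//= derivM [RHS](bigD1 i0)//=; congr (_ + _).
rewrite ih; last first.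
  apply: leq_trans Pm; apply: proper_card; apply/properP; split.
    by apply/fintype.subsetP => i /andP[].
  by exists i0 => //; rewrite unfold_in eqxx andbF.
rewrite mulr_sumr; apply: eq_bigr => i /andP[Pi ii0].
rewrite [in RHS](bigD1 i0) ?Pi0 1?eq_sym//= mulrCA; congr (_ * (_ * _)).
by apply: eq_bigl => j; rewrite andbAC.
Qed.

Lemma sum_offdiag {V : zmodType} {I : finType} (F : I -> I -> V) :
  \sum_i \sum_(j | j != i) F i j = \sum_i \sum_j F i j - \sum_i F i i.
Proof.
rewrite -sumrB; apply: eq_bigr => i _.
by rewrite [in RHS](bigD1 i)//= addrAC subrr add0r.
Qed.

(** * Generating functions of partial Bernoulli sums *)

Section bernoulli_sum.
Context {R : realType} {n : nat} (p : 'I_n -> R).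
Context (p01 : forall i, 0 <= p i <= 1).

(** This is (1 - p) + p X, arranged for expansion in powers of Y = X - 1. *)
Definition bern_factor i : {poly R} := 1 + (p i)%:P * ('X - 1).
Definition bern_gf (A : pred 'I_n) : {poly R} := \prod_(i | A i) bern_factor i.
Local Notation G := (bern_gf xpredT).
Local Notation G1 i := (bern_gf (fun k => k != i)).
Local Notation G2 i j := (bern_gf (fun k => (k != i) && (k != j))).

Lemma bern_factor1 i : (bern_factor i).[1] = 1.
Proof. by rewrite /bern_factor !hornerE subrr mulr0 addr0. Qed.

Lemma bern_gf1 A : (bern_gf A).[1] = 1.
Proof. by rewrite /bern_gf horner_prod big1// => i _; exact: bern_factor1. Qed.

Lemma bern_gf_coef_ge0 A k : 0 <= (bern_gf A)`_k.
Proof.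
rewrite /bern_gf; elim/big_ind : _ k => [k|q r q0 r0 k|i _ k].
- by rewrite coef1 ler0n.
- by rewrite coefM sumr_ge0// => j _; rewrite mulr_ge0.
- have /andP[pi0 pi1] := p01 i.
  have -> : bern_factor i = (1 - p i)%:P + (p i)%:P * 'X.
    by rewrite /bern_factor; ring.
  rewrite coefD coefC coefCM coefX.
  by rewrite addr_ge0 ?mulr_ge0//; case: eqP; rewrite ?subr_ge0.
Qed.

Lemma bern_gfD1 i : G = G1 i * (1 + (p i)%:P * ('X - 1)).
Proof. by rewrite /bern_gf (bigD1 i)//= mulrC. Qed.

Lemma bern_gfD2 i j : j != i -> G1 i = G2 i j * (1 + (p j)%:P * ('X - 1)).
Proof. by move=> ji; rewrite /bern_gf (bigD1 j)//= mulrC. Qed.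

Lemma bern_factor_deriv i : (bern_factor i)^`() = (p i)%:P.
Proof. by rewrite /bern_factor derivD derivM derivB !derivC derivX; ring. Qed.

Lemma bern_gf_deriv : G^`() = \sum_i (p i)%:P * G1 i.
Proof.
by rewrite /bern_gf deriv_prod; apply: eq_bigr => i _; rewrite bern_factor_deriv.
Qed.

Lemma bern_gf_deriv2 :
  G^`()^`() = \sum_i \sum_(j | j != i) (p i * p j)%:P * G2 i j.
Proof.
rewrite bern_gf_deriv raddf_sum/=; apply: eq_bigr => i _.
rewrite derivM derivC mul0r add0r /bern_gf deriv_prod mulr_sumr.
by apply: eq_bigr => j _; rewrite bern_factor_deriv polyCM mulrA.
Qed.

(** * Power-sum identities and the remainder of the Stein operator *)

Let l := lambda_ p.

Lemma sum_pp : \sum_i \sum_(j | j != i) p i * p j = l 1 ^+ 2 - l 2.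
Proof.
rewrite sum_offdiag; congr (_ - _).
rewrite expr2 /l /lambda_ mulr_suml; apply: eq_bigr => i _.
by rewrite mulr_sumr; apply: eq_bigr => j _; rewrite !expr1.
Qed.

Lemma sum_ppp : \sum_i \sum_j p i * p j * (p i + p j) = 2 * l 1 * l 2.
Proof.
have -> : 2 * l 1 * l 2 = l 2 * l 1 + l 1 * l 2 by ring.
rewrite /l /lambda_ !mulr_suml -big_split/=; apply: eq_bigr => i _.
rewrite !mulr_sumr -big_split/=; apply: eq_bigr => j _.
by rewrite !expr1; ring.
Qed.

(** The coefficient of Y G in X G''; it equals beta lambda_2, which is how beta is chosen. *)
Lemma sum_pp1 : \sum_i \sum_(j | j != i) p i * p j * (1 - p i - p j) =
  l 1 ^+ 2 - l 2 - 2 * l 1 * l 2 + 2 * l 3.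
Proof.
rewrite (eq_bigr (fun i => \sum_(j | j != i) p i * p j -
    \sum_(j | j != i) p i * p j * (p i + p j))); last first.
  by move=> i _; rewrite -sumrB; apply: eq_bigr => j _; ring.
have diag : \sum_i p i * p i * (p i + p i) = 2 * l 3.
  by rewrite /l /lambda_ mulr_sumr; apply: eq_bigr => i _; ring.
by rewrite sumrB sum_pp sum_offdiag sum_ppp diag; ring.
Qed.

Let alpha := pbd_alpha p.
Let beta := pbd_beta p.
Let Y : {poly R} := 'X - 1.

Let rem1 : {poly R} := \sum_i (p i ^+ 3)%:P * G1 i.
(* From X = 1 + Y: with s = a + b and q = a b, dividing
   X - (1 + (1 - s) Y) (1 + a Y) (1 + b Y) by - Y^2 leaves
   (1 - s) (s + q Y) + q, whose coefficients in X are the ones below. *)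
Let rem2coef (a b : R) : {poly R} :=
  ((a + b) * ((1 - a) * (1 - b)))%:P + ((1 - a - b) * (a * b))%:P * 'X.
Let rem2 : {poly R} :=
  \sum_i \sum_(j | j != i) (p i * p j)%:P * (rem2coef (p i) (p j) * G2 i j).

(* [alpha] and [beta] annihilate the terms of order 0 and 1 in [Y]. *)
Lemma bern_gf_stein : l 2 != 0 ->
  alpha%:P * G - beta%:P * G^`() - 'X * G^`()^`() =
  (rem2 - beta%:P * rem1) * Y ^+ 2.
Proof.
move=> l2.
(* Applying G = G1 (1 + p Y) twice gives G1 = G - p Y G + p^2 Y^2 G1. *)
have E1 : G^`() = (l 1)%:P * G - (l 2)%:P * (Y * G) + rem1 * Y ^+ 2.
  rewrite bern_gf_deriv /l /lambda_ !rmorph_sum /rem1 !mulr_suml.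
  rewrite -sumrB -big_split/=.
  by apply: eq_bigr => i _; rewrite (bern_gfD1 i) /Y; ring.
have E2 : 'X * G^`()^`() = (l 1 ^+ 2 - l 2)%:P * G +
    (l 1 ^+ 2 - l 2 - 2 * l 1 * l 2 + 2 * l 3)%:P * (Y * G) - rem2 * Y ^+ 2.
  rewrite bern_gf_deriv2 -sum_pp1 -sum_pp /rem2 !rmorph_sum !mulr_suml.
  rewrite mulr_sumr -big_split -sumrB/=; apply: eq_bigr => i _.
  rewrite !rmorph_sum !mulr_suml mulr_sumr -big_split -sumrB/=.
  apply: eq_bigr => j ji.
  by rewrite (bern_gfD1 i) (bern_gfD2 _ _ ji) /rem2coef /Y; ring.
have B2 : beta * l 2 = l 1 ^+ 2 - l 2 - 2 * l 1 * l 2 + 2 * l 3.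
  by rewrite /beta /pbd_beta -/l; field.
rewrite E2 E1 -B2 /alpha /pbd_alpha -/l -/beta; ring.
Qed.

(** With s = a + b and q = a b, the left side is s - s^2 + q if s <= 1 and s - s^2 + (2 s - 1) q
    otherwise; 4 q <= s^2 and s <= 2 conclude. *)
Lemma rem2coef_bound (a b : R) : 0 <= a <= 1 -> 0 <= b <= 1 ->
  `|(a + b) * ((1 - a) * (1 - b))| + `|(1 - a - b) * (a * b)| <= a + b.
Proof.
move=> /andP[a0 a1] /andP[b0 b1].
have ab0 := mulr_ge0 a0 b0.
rewrite ger0_norm; last by rewrite mulr_ge0 ?addr_ge0// mulr_ge0 ?subr_ge0.
have [s1|s1] := leP (a + b) 1.
  rewrite ger0_norm; first by nra.
  by rewrite mulr_ge0//; lra.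
rewrite ler0_norm; last by rewrite mulr_le0_ge0//; lra.
nra.
Qed.

Lemma bern_stein_error phi c : 0 <= c -> 0 <= beta ->
  (forall k, `|phi k| <= c) ->
  `|pairing (rem2 - beta%:P * rem1) phi| <= c * (beta * l 3 + 2 * l 1 * l 2).
Proof.
move=> c0 b0 phic.
have bound A q : (forall k, `|q k| <= c) -> `|pairing (bern_gf A) q| <= c.
  move=> qc; rewrite -[leRHS]mulr1 -(bern_gf1 A).
  by apply: pairing_bound => // k; exact: bern_gf_coef_ge0.
have p0 i : 0 <= p i by have /andP[] := p01 i.
rewrite pairingD pairingN addrC mulrDr; apply: le_trans (ler_normD _ _) _.
apply: lerD; rewrite ?normrN.
  rewrite pairingZ pairing_sum normrM (ger0_norm b0) mulrCA ler_wpM2l//.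
  rewrite /l /lambda_ mulr_sumr; apply: le_trans (ler_norm_sum _ _ _) _.
  apply: ler_sum => i _; rewrite pairingZ normrM ger0_norm ?exprn_ge0//.
  by rewrite mulrC ler_wpM2r ?exprn_ge0// bound.
rewrite -sum_ppp pairing_sum mulr_sumr; apply: le_trans (ler_norm_sum _ _ _) _.
apply: ler_sum => i _; rewrite pairing_sum mulr_sumr.
(* The nonnegative diagonal terms are added to reach the full double sum of [sum_ppp]. *)
rewrite [leRHS](bigID (fun j => j != i))/= -[leLHS]addr0.
apply: lerD; last first.
  by apply: sumr_ge0 => j _; rewrite !mulr_ge0// addr_ge0.
apply: le_trans (ler_norm_sum _ _ _) _; apply: ler_sum => j _.
rewrite pairingZ normrM ger0_norm ?mulr_ge0// mulrCA ler_wpM2l ?mulr_ge0//.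
rewrite /rem2coef [(_ + _) * bern_gf _]mulrDl pairingD pairingZ.
rewrite -[_ * 'X * _]mulrA pairingZ ['X * _]mulrC pairingX.
apply: le_trans (ler_wpM2l c0 (rem2coef_bound _ _ (p01 i) (p01 j))).
rewrite [leRHS]mulrDr; apply: le_trans (ler_normD _ _) _.
by apply: lerD; rewrite normrM mulrC ler_wpM2r ?bound.
Qed.

(** Multiplication by k and by k (k - 1) correspond to X d/dX and X^2 d^2/dX^2. *)
Lemma bern_gf_death (g : nat -> R) :
  pairing G (fun k => pbd_death beta k * g k) =
  pairing ((beta%:P * G^`() + 'X * G^`()^`()) * 'X) g.
Proof.
rewrite (@pairing_ext _ _ _
  (fun k => k%:R * (beta * g k + 1 * ((k%:R - 1) * g k)))).
  rewrite -pairing_deriv pairing_linr [X in _ = pairing X _]mulrDl pairingD.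
  rewrite -[_ * _ * 'X]mulrA pairingZ mul1r; congr (_ + _); rewrite pairingX.
  rewrite (@pairing_ext _ _ _ (fun k => k%:R * g k.+1)); last first.
    by move=> k /=; rewrite -natr1 addrK.
  by rewrite -pairing_deriv -pairingX; congr pairing; ring.
by move=> k; rewrite /pbd_death; ring.
Qed.

(** The common factor X shifts g by one, so that g(0) never enters, and the factor Y^2 of the
    remainder turns g into its second differences. *)
Lemma bern_stein_bound (f g : nat -> R) (C c : R) :
  l 2 != 0 -> 0 <= c -> 0 <= beta ->
  (forall k, alpha * g k.+1 - pbd_death beta k * g k = f k - C) ->
  (forall k, `|g k.+3 - 2 * g k.+2 + g k.+1| <= c) ->
  `|pairing G f - C| <= c * (beta * l 3 + 2 * l 1 * l 2).
Proof.
move=> l2 c0 b0 eqn bnd.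
have -> : pairing G f - C = pairing G (fun k => 1 * f k + (-1) * C).
  by rewrite pairing_linr pairing_cst bern_gf1; ring.
rewrite (@pairing_ext _ _ _
  (fun k => alpha * g k.+1 + (-1) * (pbd_death beta k * g k))); last first.
  by move=> k; rewrite !mulN1r eqn mul1r.
rewrite pairing_linr bern_gf_death -pairingX mulN1r -pairingN -pairingZ -pairingD.
have -> : alpha%:P * (G * 'X) - (beta%:P * G^`() + 'X * G^`()^`()) * 'X =
    (alpha%:P * G - beta%:P * G^`() - 'X * G^`()^`()) * 'X by ring.
rewrite bern_gf_stein// pairingX expr2 mulrA !pairing_diff.
apply: bern_stein_error => // k; apply: le_trans (bnd k).
by rewrite le_eqVlt; apply/orP; left; apply/eqP; congr `|_|; ring.
Qed.

(** * Coefficients as sums over 0-1 outcomes *)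

Definition bern_weight (F : {ffun 'I_n -> bool}) : R :=
  \prod_i (if F i then p i else 1 - p i).

Lemma bern_gf_expand :
  G = \sum_F (bern_weight F)%:P * 'X^(\sum_i F i).
Proof.
rewrite /bern_gf (eq_bigr (fun i => \sum_(b : bool)
    (if b then p i else 1 - p i)%:P * 'X^b)); last first.
  by move=> i _; rewrite big_bool/= expr1 expr0 /bern_factor; ring.
rewrite bigA_distr_bigA; apply: eq_bigr => F _.
by rewrite big_split/= prodrXr /bern_weight rmorph_prod.
Qed.

Lemma bern_gf_coefE k :
  G`_k = \sum_(F : {ffun 'I_n -> bool} | (\sum_i F i)%N == k) bern_weight F.
Proof.
rewrite bern_gf_expand coef_sum [RHS]big_mkcond/=; apply: eq_bigr => F _.
by rewrite coefCM coefXn eq_sym; case: eqP => _; rewrite ?mulr1 ?mulr0.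
Qed.

Lemma bern_weight_sum : \sum_F bern_weight F = 1.
Proof.
rewrite -(bern_gf1 xpredT) bern_gf_expand horner_sum; apply: eq_bigr => F _.
by rewrite hornerM hornerC hornerXn expr1n mulr1.
Qed.

End bernoulli_sum.

(** * Laws on the natural numbers *)

Lemma sum_disjoint_le {d} {T : measurableType d} {R : realType}
    (mu : {measure set T -> \bar R}) {I : eqType} (s : seq I) (E : I -> set T)
    (B : set T) :
  measurable B -> (forall i, measurable (E i)) ->
  (forall i j, i != j -> E i `&` E j = set0) ->
  uniq s -> (forall i, i \in s -> E i `<=` B) ->
  (\sum_(i <- s) mu (E i) <= mu B)%E.
Proof.
move=> mB mE disj; elim: s B mB => [|i s ih] B mB; first by rewrite big_nil.
move=> /= /andP[ins us] sB; rewrite big_cons (measureDI mu mB (mE i)) addeC.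
apply: leeD.
  apply: ih => //; first exact: measurableD.
  move=> j js t Ejt; split; first by apply: sB Ejt; rewrite inE js orbT.
  move=> Eit; have : (E i `&` E j) t by [].
  by rewrite disj//; apply: contraNneq ins => ->.
rewrite (_ : B `&` E i = E i)//; apply/seteqP; split => [t []//|t Eit].
by split=> //; apply: sB Eit; rewrite inE eqxx.
Qed.

(** The integral is split over singletons; the absolute series supplies integrability. *)
Lemma integral_nat_series {R : realType} (m : {measure set nat -> \bar R})
    (q f : nat -> R) (l : R) :
  (forall k, m [set k] = (q k)%:E) ->
  cvgn (series (fun k => `|f k| * q k)) ->
  series (fun k => f k * q k) @ \oo --> l ->
  (\int[m]_x (f x)%:E = l%:E)%E.
Proof.
move=> mq abscvg fl.
have triv : trivIset [set: nat] (fun k : nat => [set k]).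
  by move=> i j _ _ [x [/= -> ->]].
have cover : [set: nat] = \bigcup_k [set k].
  by apply/seteqP; split=> // x _; exists x.
have int1 (g : nat -> R) k : (\int[m]_(x in [set k]) (g x)%:E = (g k * q k)%:E)%E.
  rewrite (eq_integral (cst (g k)%:E)); last by move=> x /[1!inE] /= ->.
  by rewrite integral_cst// mq -EFinM.
have serE (g : nat -> R) c : series (fun k => g k * q k) @ \oo --> c ->
    (\sum_(0 <= k <oo) (g k * q k)%:E = c%:E)%E.
  move=> gc; rewrite -(cvg_lim _ gc)// -EFin_lim; last by apply/cvg_ex; exists c.
  by apply/congr_lim/funext => N /=; rewrite /series/= sumEFin.
have fint : m.-integrable setT (EFin \o f).
  apply/integrableP; split=> //.
  rewrite (_ : (fun _ => _) = (fun x => (`|f x|)%:E)); last by apply/funext.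
  rewrite {1}cover ge0_integral_bigcup//.
  under eq_eseriesr do rewrite int1.
  by move/cvg_ex: abscvg => [c /serE ->]; rewrite ltry.
rewrite {1}cover integral_bigcup// -?cover//.
by under eq_eseriesr do rewrite int1; exact: serE.
Qed.

(** * The law of a sum of independent Bernoulli variables *)

Section bernoulli_law.
Context {d : measure_display} {T : measurableType d} {R : realType}.
Context {P : probability T R} {n : nat} {p : 'I_n -> R}.
Context {X : 'I_n -> {RV P >-> nat}}.
Context (X_bernoulli : forall i,
  P [set t | X i t = 1%N] = (p i)%:E /\ P [set t | X i t = 0%N] = (1 - p i)%:E).
Context (X_indep : mutually_independent X).

Let atom (F : {ffun 'I_n -> bool}) : set T :=
  \bigcap_(i in [set` [set: 'I_n]%SET]) X i @^-1` [set (F i : nat)].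

Let atomP F t : atom F t <-> forall i, X i t = F i.
Proof.
split=> [h i|h i _]; last exact: h.
by apply: h; rewrite /= inE.
Qed.

Let measurable_atom F : measurable (atom F).
Proof.
apply: fin_bigcap_measurable => // i _.
by rewrite -[X in measurable X]setTI; exact: measurable_funP.
Qed.

Let atom_mass F : P (atom F) = (bern_weight p F)%:E.
Proof.
rewrite /atom X_indep// /bern_weight -prodEFin; apply: eq_big => [i|i _].
  by rewrite inE.
by have [h1 h0] := X_bernoulli i; case: (F i); [exact: h1|exact: h0].
Qed.

Let atom_disjoint F H : F != H -> atom F `&` atom H = set0.
Proof.
move=> FH; apply/seteqP; split=> // t [/atomP tF /atomP tH].
move/eqP: FH; apply; apply/ffunP => i.
by have := tH i; rewrite tF; case: (F i) (H i) => [] [].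
Qed.

(** The X_i take values 0 and 1 only almost surely, so the atoms need not cover the space. They
    bound P(W = k) and P(W != k) from below, and these bounds add up to 1, so both are
    equalities. *)
Lemma rv_sum_mass k : P (rv_sum X @^-1` [set k]) = ((bern_gf p xpredT)`_k)%:E.
Proof.
set B := _ @^-1` _.
have mB : measurable B by rewrite -[B]setTI; exact: measurable_funP.
have lower (Q : pred {ffun 'I_n -> bool}) A : measurable A ->
    (forall F, Q F -> atom F `<=` A) ->
    ((\sum_(F | Q F) bern_weight p F)%:E <= P A)%E.
  move=> mA QA; rewrite -sumEFin.
  under eq_bigr do rewrite -atom_mass.
  rewrite -big_filter; apply: sum_disjoint_le => //.
    by rewrite filter_uniq// index_enum_uniq.
  by move=> F; rewrite mem_filter => /andP[/QA].
have atom_sum F t : atom F t -> rv_sum X t = (\sum_i F i)%N.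
  by move=> /atomP tF; apply: eq_bigr => i _; rewrite tF.
apply/eqP; rewrite eq_le bern_gf_coefE; apply/andP; split; last first.
  by apply: lower => // F /eqP Fk t /atom_sum; rewrite /B/= Fk.
have : ((\sum_(F : {ffun 'I_n -> bool} | (\sum_i F i)%N != k) bern_weight p F)%:E
    <= P (~` B))%E.
  apply: lower; first exact: measurableC.
  by move=> F /eqP Fk t /atom_sum tF; rewrite /B/= tF.
rewrite probability_setC// -(fineK (fin_num_measure P _ mB)).
rewrite -EFinB !lee_fin => h.
have := bern_weight_sum p.
rewrite (bigID (fun F : {ffun _ -> bool} => (\sum_i F i)%N == k))/=.
by lra.
Qed.

End bernoulli_law.

(** * Balance, total mass and positivity of the polynomial birth-death law *)

Section pbd_mass.
Context {R : realType} {alpha beta : R}.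
Context (alpha_gt0 : 0 < alpha) (beta_gt0 : 0 < beta).
Local Notation mu := (pbd_pmf alpha beta).

Lemma pbd_balance k : pbd_death beta k.+1 * mu k.+1 = alpha * mu k.
Proof.
rewrite /pbd_pmf /bd_pmf mulrA mulrA; congr (_ * _).
rewrite /bd_weight big_nat_recr//= [in X in _ / X]big_nat_recr//= invfM.
rewrite {2}/pbd_birth.
rewrite [LHS](_ : _ = (alpha * (\prod_(0 <= i < k) pbd_birth alpha i
    / \prod_(1 <= i < k.+1) pbd_death beta i)) *
    ((pbd_death beta k.+1)^-1 * pbd_death beta k.+1)); last by ring.
by rewrite mulVf ?mulr1// gt_eqF// pbd_deathS_gt0.
Qed.

Lemma pbd_mass_sum : series mu @ \oo --> (1 : R).
Proof.
have mu_ge0 k : (0 <= (mu k)%:E)%E by rewrite lee_fin pbd_pmf_ge0// ltW.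
have mu1 : (\sum_(0 <= k <oo) (mu k)%:E = 1%:E)%E.
  have h : pbd alpha beta [set: nat] = 1%E := probability_setT _.
  by rewrite nneseries_esumT// -h /pbd (ltW alpha_gt0) beta_gt0.
have : (fun N => \sum_(0 <= k < N) (mu k)%:E)%E @ \oo --> 1%:E.
  rewrite -mu1; apply: is_cvg_nneseries => // k _ _; exact: mu_ge0.
move/fine_cvgP => [_]; apply: cvg_trans; apply: near_eq_cvg; apply: nearW => N.
by rewrite /= sumEFin.
Qed.

Lemma pbd_mass_gt0 k : 0 < mu k.
Proof.
elim: k => [|k ih]; last first.
  by rewrite -(pmulr_rgt0 _ (pbd_deathS_gt0 beta_gt0 k)) pbd_balance mulr_gt0.
(* If the mass at 0 vanished, balance would make every mass vanish, against total mass 1. *)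
rewrite lt_def pbd_pmf_ge0 ?(ltW alpha_gt0)// andbT; apply/eqP => mu0.
have z k : mu k = 0.
  elim: k => // k ih; apply/eqP; have := pbd_balance k; rewrite ih mulr0 => /eqP.
  by rewrite mulf_eq0 gt_eqF// pbd_deathS_gt0.
have : series mu @ \oo --> (0 : R).
  by apply: cvg_near_cst; apply: nearW => N; rewrite /series/= big1.
move/(cvg_unique _ pbd_mass_sum) => /(_ (@Rhausdorff R)) /eqP.
by rewrite oner_eq0.
Qed.

End pbd_mass.

(** * Comparison of constants and the final bound *)

Lemma pbd_bound_simplify {R : realType} (a b c beta alpha : R) :
  0 < a -> 0 < b -> 0 < c -> 0 <= a ^+ 2 / b - 1 - 2 * a ->
  beta = a ^+ 2 / b - 1 - 2 * a + 2 * c / b ->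
  alpha = beta * a + a ^+ 2 - b ->
  3 / alpha * (beta * c + 2 * a * b) <=
  3 * (c / a) + 6 * (b / a) * b / (a - b - (1 + b / a) * (b / a)).
Proof.
move=> a0 b0 c0 h betaE alphaE.
have a_neq0 : a != 0 by rewrite gt_eqF.
have b_neq0 : b != 0 by rewrite gt_eqF.
have ab0 := mulr_gt0 a0 b0; have ac0 := mulr_gt0 a0 c0.
have hb : b + 2 * a * b <= a ^+ 2.
  have := mulr_ge0 (ltW b0) h.
  have -> : b * (a ^+ 2 / b - 1 - 2 * a) = a ^+ 2 - b - 2 * a * b by field.
  by lra.
have beta_b : beta * b = a ^+ 2 - b - 2 * a * b + 2 * c by rewrite betaE; field.
have beta0 : 0 < beta.
  by rewrite -(pmulr_lgt0 _ b0) beta_b; lra.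
have alpha_ge : beta * a <= alpha by rewrite alphaE; lra.
have alpha0 : 0 < alpha by apply: lt_le_trans alpha_ge; exact: mulr_gt0.
set den := a - b - _.
have den_a : a ^+ 2 * den = a ^+ 3 - a ^+ 2 * b - a * b - b ^+ 2.
  by rewrite /den; field.
(* This yields a^2 / (alpha b) <= 1 / den for the second summand; [alpha_ge] yields beta c / alpha
   <= c / a for the first. *)
have alpha_b : alpha * b = a ^+ 2 * den + 2 * (a * c).
  rewrite den_a (_ : alpha * b = beta * b * a + a ^+ 2 * b - b ^+ 2); last first.
    by rewrite alphaE; ring.
  by rewrite beta_b; ring.
(* Using [hb] times a, then [hb] times b: a^2 den >= a^2 b - b^2 >= 2 a b^2 > 0. *)
have den0 : 0 < den.
  rewrite -(pmulr_rgt0 _ (exprn_gt0 2 a0)) den_a.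
  have := ler_wpM2l (ltW a0) hb; have := ler_wpM2l (ltW b0) hb.
  have := mulr_gt0 ab0 b0; have := mulr_gt0 ab0 a0; nra.
rewrite mulrDr; apply: lerD.
  rewrite mulrAC ler_pdivrMr// -!mulrA ler_pM2l// mulrC ler_pM2l// mulrC.
  by rewrite ler_pdivlMr.
have -> : 3 / alpha * (2 * a * b) = 6 * (b / a * b) * (a ^+ 2 / (alpha * b)).
  by field; rewrite a_neq0 b_neq0 gt_eqF.
rewrite -[6 * (b / a) * b]mulrA ler_pM2l; last by rewrite !mulr_gt0 ?invr_gt0.
rewrite ler_pdivrMr ?mulr_gt0// ler_pdivlMl// mulrC alpha_b.
by lra.
Qed.

Theorem theorem1p4 (R : realType) (d : measure_display) (T : measurableType d)
    (P : probability T R) (n : nat) (p : 'I_n -> R)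
    (X : 'I_n -> {RV P >-> nat})
    (p01 : forall i, 0 <= p i <= 1)
    (p_neq0 : exists i, p i != 0)
    (X_bernoulli : forall i,
      P [set t | X i t = 1%N] = (p i)%:E /\
      P [set t | X i t = 0%N] = (1 - p i)%:E)
    (X_indep : mutually_independent X)
    (hlambda : 0 <= lambda_ p 1 ^+ 2 / lambda_ p 2 - 1 - 2 * lambda_ p 1) :
  (wasserstein (distribution P (rv_sum X))
     (pbd (pbd_alpha p) (pbd_beta p)) <=
   (3 * theta_ p 3 +
    6 * theta_ p 2 * lambda_ p 2 /
      (lambda_ p 1 - lambda_ p 2 - (1 + theta_ p 2) * theta_ p 2))%:E)%E.
Proof.
have l_gt0 r := lambda_gt0 r p01 p_neq0.
have [_ beta0] := pbd_params_valid p01 p_neq0 hlambda.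
(* Strict positivity, for division by alpha: beta lambda > 0 and lambda^2 >= lambda_2. *)
have alpha0 : 0 < pbd_alpha p.
  rewrite /pbd_alpha -addrA ltr_pwDl ?mulr_gt0// subr_ge0.
  rewrite -[leLHS]mul1r -ler_pdivlMr// -subr_ge0.
  by apply: le_trans hlambda _; rewrite gerBl mulr_ge0// ltW.
have bal := @pbd_balance R (pbd_alpha p) _ beta0.
have mass0 := pbd_mass_gt0 alpha0 beta0.
have mass1 := pbd_mass_sum alpha0 beta0.
apply: ge_ereal_sup => _ [f flip <-].
have lip (g : nat -> R) : lip1 g -> forall k, `|fdiff g k| <= 1.
  move=> gl k; apply: le_trans (gl _ _) _.
  by rewrite -natr1 addrAC subrr add0r normr1.
(* Applying [stein_mean_cvg] to |f| gives the absolute convergence behind integrability. *)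
have abs_lip : lip1 (fun k => `|f k|).
  by move=> x y; apply: le_trans (ler_dist_dist _ _) (flip x y).
rewrite (integral_nat_series _ (fun k => (bern_gf p xpredT)`_k) f
    (pairing (bern_gf p xpredT) f)); last 3 first.
- by move=> k; exact: (rv_sum_mass X_bernoulli X_indep k).
- by apply/cvg_ex; eexists; exact: pairing_cvg.
- exact: pairing_cvg.
rewrite (integral_nat_series _ (pbd_pmf (pbd_alpha p) (pbd_beta p)) f
    (stein_mean (mu := pbd_pmf (pbd_alpha p) (pbd_beta p)) f)); last 3 first.
- by move=> k; exact: pbd_set1 (ltW alpha0) beta0.
- apply/cvg_ex; eexists; apply: (stein_mean_cvg alpha0 beta0 mass0 bal mass1).
  exact: lip.
- by apply: (stein_mean_cvg alpha0 beta0 mass0 bal mass1); exact: lip.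
rewrite -EFinB abse_EFin lee_fin.
apply: le_trans (bern_stein_bound p p01 _ _ _ (3 / pbd_alpha p) _ _ _
  (stein_equation alpha0 mass0 bal f)
  (stein_fun_second_diff alpha0 beta0 mass0 bal mass1 f (lip _ flip))) _.
- by rewrite gt_eqF.
- by rewrite divr_ge0// ltW.
- exact: ltW.
exact: pbd_bound_simplify.
Qed.
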